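(* Let $X$ be a real Hilbert space, let $M_1,\dots,M_k$ be finitely many closed linear subspaces of $X$, let $M:=\bigcap_{l=1}^k M_l$, and let $x_0\in X$. Let $\{x_i\}_{i\ge 0}$, $\{\tilde x_i\}_{i\ge 0}$ (with associated indices $l_i$, vectors $a_i$, index sets $J_i$ and subspaces $\tilde H_i$) be infinite sequences generated from $x_0$ by the Accelerated Projections algorithm. Suppose that: (A) There is a number $\bar p$ such that for all $l\in\{1,\dots,k\}$ and all $i>0$ there is an integer $p_i^l\in[0,\bar p]$ such that $\tilde x_{i+p_i^l}=P_{M_l}(x_{i+p_i^l})$. (B) The $\tilde H_i$ are chosen such that $x_0-x_i\in\mathrm{span}(\{a_j:j\in J_i\})$ for all iterations $i$. Then the sequence $\{x_i\}_i$ converges strongly (i.e. in norm) to $P_M(x_0)$.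
   Context: For a closed linear (or affine) subspace $N$ of $X$, $P_N$ denotes the orthogonal projection onto $N$. Accelerated Projections algorithm: given closed linear subspaces $M_1,\dots,M_k$ of $X$ and a starting point $x_0\in X$, for $i=0,1,2,\dots$ (run indefinitely): Step 1: choose $l_i\in\{1,\dots,k\}$ and set $\tilde x_i:=P_{M_{l_i}}(x_i)$. Put $a_i:=x_i-P_{M_{l_i}}(x_i)\in X$, $b_i:=\langle a_i,P_{M_{l_i}}(x_i)\rangle\in\mathbb{R}$, and $H_i:=\{x\in X:\langle a_i,x\rangle=b_i\}$ (so $M\subset M_{l_i}\subset H_i$; when $a_i=0$, $H_i=X$). Step 2: choose $J_i\subset\{0,1,\dots,i\}$ with $i\in J_i$, put $\tilde H_i:=\bigcap_{j\in J_i}H_j$, and set $x_{i+1}:=P_{\tilde H_i}(\tilde x_i)$. *)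

(* Defs.v *)
From HB Require Import structures.
From mathcomp Require Import all_boot all_order all_algebra.
From mathcomp Require Import all_classical all_reals all_analysis.
Set Implicit Arguments.
Unset Strict Implicit.
Unset Printing Implicit Defensive.
Import Order.TTheory GRing.Theory Num.Theory.
Import numFieldNormedType.Exports.
Local Open Scope classical_set_scope.
Local Open Scope ring_scope.

Section AcceleratedProjections.
Context {R : realType} {X : completeNormedModType R}.

(* A real Hilbert space is a complete normed space whose norm is the one
   induced by an inner product. *)
Definition hilbert_space (dot : {dot X for idfun}) : Prop :=
  forall x : X, `|x| = Num.sqrt (dot x x).

Definition closed_subspace (S : set X) : Prop :=
  closed S /\ submod_closed [in S].

Definition lin_span (A : set X) : set X :=
  [set v | exists (n : nat) (c : 'I_n -> R) (u : 'I_n -> X),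
     (forall j, A (u j)) /\ v = \sum_(j < n) c j *: u j].

(* Orthogonal projection onto a closed linear or affine subspace [N]: the point
   [p] of [N] such that [x - p] is orthogonal to the direction of [N]. The
   default value 0 is returned only if there is no such point. *)
Definition orth_proj (dot : {dot X for idfun}) (N : set X) (x : X) : X :=
  xget 0 [set p | N p /\ forall y, N y -> dot (x - p) (y - p) = 0].

Section Iteration.
Variables (dot : {dot X for idfun}) (k : nat) (M : 'I_k -> set X).
Variables (x : nat -> X) (l : nat -> 'I_k) (J : nat -> set nat).

Definition ap_a (i : nat) : X := x i - orth_proj dot (M (l i)) (x i).
Definition ap_b (i : nat) : R := dot (ap_a i) (orth_proj dot (M (l i)) (x i)).
Definition ap_H (i : nat) : set X := [set y | dot (ap_a i) y = ap_b i].
Definition ap_Ht (i : nat) : set X := \bigcap_(j in J i) ap_H j.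

End Iteration.

Record accelerated_projections (dot : {dot X for idfun}) (k : nat)
    (M : 'I_k -> set X) (x0 : X) (x xt : nat -> X)
    (l : nat -> 'I_k) (J : nat -> set nat) : Prop := {
  ap_init : x 0%N = x0 ;
  ap_step1 : forall i, xt i = orth_proj dot (M (l i)) (x i) ;
  ap_J_le : forall i j, J i j -> (j <= i)%N ;
  ap_J_self : forall i, J i i ;
  ap_step2 : forall i, x i.+1 = orth_proj dot (ap_Ht dot M x l J i) (xt i) }.

End AcceleratedProjections.

(* Main.v *)
Require Import Defs.
From HB Require Import structures.
From mathcomp Require Import all_boot all_order all_algebra.
From mathcomp Require Import all_classical all_reals all_analysis.
From mathcomp Require Import ring lra.
Import Order.TTheory GRing.Theory Num.Theory.
Import numFieldNormedType.Exports.
Local Open Scope classical_set_scope.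
Local Open Scope ring_scope.

(** Since the M_l are linear, a_i is orthogonal to M_(l i) and b_i = 0: H_i is
    the hyperplane orthogonal to a_i (X itself if a_i = 0), and Ht_i is the
    closed linear subspace orthogonal to all a_j with j in J_i; it contains the
    intersection of the M_l, written Mcap.

    Energy: x_i - x_(i+1) = a_i + (xt_i - x_(i+1)) is orthogonal to Ht_i, hence
    to x_(i+1), so |x_i - x_(i+1)|^2 = |x_i|^2 - |x_(i+1)|^2.  The norms
    decrease, the steps tend to 0, and so do the residuals a_i, which are
    bounded by the steps.  By (A), x_i is within a bounded number of vanishing
    steps of a point of M_m, for each m ([dot_orth_cvg0]).

    Weak convergence: let y be the projection of x0 on Mcap.  The vectors u with
    <x_i - y, u> -> 0 form a closed subspace, because x_i is bounded.  It
    contains Mcap, as x_i - y is orthogonal to Mcap, and it contains every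
    M_m^perp by the previous paragraph.  A vector orthogonal to all of these
    lies in every M_m and in Mcap^perp, so it is 0; by the projection theorem
    the subspace is the whole space.  This duality argument replaces the
    extraction of weak cluster points.

    Strong convergence: (B) makes x0 - x_i orthogonal both to Mcap and to x_i
    ([drift_orth_iterate]), so |x_i - y|^2 = <x_i - y, x0 - y>, which tends to 0
    by weak convergence tested against the one vector x0 - y. *)

(** * Real inner products *)

Section InnerProduct.
Context {R : realType} {X : completeNormedModType R} (dot : {dot X for idfun}).

Lemma dotC u v : dot u v = dot v u.
Proof. by have := hermC dot u v; rewrite /= expr0 mul1r. Qed.

Lemma dotDl u v w : dot (u + v) w = dot u w + dot v w.
Proof. exact: (linearDl dot w u v). Qed.

Lemma dotBl u v w : dot (u - v) w = dot u w - dot v w.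
Proof. exact: (linearBl dot w u v). Qed.

Lemma dotZl a u w : dot (a *: u) w = a * dot u w.
Proof. exact: (linearZl_LR dot w a u). Qed.

Lemma dotDr u v w : dot w (u + v) = dot w u + dot w v.
Proof. exact: (linearDr dot w u v). Qed.

Lemma dotBr u v w : dot w (u - v) = dot w u - dot w v.
Proof. exact: (linearBr dot w u v). Qed.

Lemma dotZr a u w : dot w (a *: u) = a * dot w u.
Proof. exact: (linearZr_LR dot w a u). Qed.

Lemma dot_suml n (v : 'I_n -> X) w :
  dot (\sum_(j < n) v j) w = \sum_(j < n) dot (v j) w.
Proof. exact: (linear_sumlz dot w). Qed.

Lemma dot0l w : dot 0 w = 0. Proof. exact: linear0l. Qed.
Lemma dot0r w : dot w 0 = 0. Proof. exact: linear0r. Qed.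

Lemma dot_ge0 u : 0 <= dot u u.
Proof.
by have [->|/(@neq0_dnorm_gt0 _ _ _ dot)/ltW//] := eqVneq u 0; rewrite dot0l.
Qed.

Lemma dot_eq0 u : dot u u = 0 -> u = 0.
Proof.
move=> u0; apply/eqP/negP => /negP/(@neq0_dnorm_gt0 _ _ _ dot).
by rewrite u0 ltxx.
Qed.

Hypothesis hX : hilbert_space dot.

Lemma sqr_normE u : `|u| ^+ 2 = dot u u.
Proof. by rewrite hX sqr_sqrtr// dot_ge0. Qed.

Lemma cauchy_schwarz u v : `|dot u v| <= `|u| * `|v|.
Proof.
have [->|v0] := eqVneq v 0; first by rewrite dot0r !normr0 mulr0.
have vv : 0 < dot v v by exact: (@neq0_dnorm_gt0 _ _ _ dot).
rewrite -(@ler_pXn2r _ 2) ?nnegrE ?mulr_ge0// exprMn.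
rewrite !sqr_normE real_normK ?num_real//.
(* up to the factor dot v v, the component of u orthogonal to v *)
have := dot_ge0 (dot v v *: u - dot u v *: v).
rewrite !(dotBl, dotBr, dotZl, dotZr) (dotC v u) => h.
by rewrite -subr_ge0 -(pmulr_rge0 _ vv); move: h; congr (_ <= _); ring.
Qed.

Lemma dot_continuous u : continuous (dot u : X -> R).
Proof.
move=> v; apply/cvgrPdist_le => e e0.
have d0 : 0 < e / (`|u| + 1) by rewrite divr_gt0// ltr_wpDl.
near=> w; rewrite -dotBr; apply: le_trans (cauchy_schwarz _ _) _.
apply: (@le_trans _ _ ((`|u| + 1) * (e / (`|u| + 1)))); last first.
  by rewrite mulrC divfK// gt_eqF// ltr_wpDl.
apply: ler_pM; [by []|by []|by rewrite lerDl|].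
by near: w; apply: cvgr_dist_le.
Unshelve. all: by end_near. Qed.

(** * The projection theorem *)

Section Projection.
Variable S : set X.
Hypothesis hS : closed_subspace S.

Lemma subspace0 : S 0.
Proof. by have [_ [/set_mem]] := hS. Qed.

Lemma subspaceP a u v : S u -> S v -> S (a *: u + v).
Proof.
move=> Su Sv; have [_ [_ h]] := hS; apply: set_mem.
by apply: h; exact: mem_set.
Qed.

Lemma subspaceD u v : S u -> S v -> S (u + v).
Proof. by move=> Su Sv; rewrite -(scale1r u); exact: subspaceP. Qed.

Lemma subspaceZ a u : S u -> S (a *: u).
Proof.
move=> Su; rewrite -(addr0 (_ *: _)).
by apply: subspaceP => //; exact: subspace0.
Qed.

Lemma subspaceB u v : S u -> S v -> S (u - v).
Proof. by move=> Su Sv; rewrite addrC -scaleN1r; exact: subspaceP. Qed.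

(** A minimizing sequence of S is Cauchy: the midpoint of two of its points is
    in S, hence not closer to x than the infimum, and the parallelogram law then
    bounds their distance.  Its limit p minimizes the distance to x, and the
    first variation at p gives orthogonality. *)
Lemma projection_theorem x :
  exists p, S p /\ forall y, S y -> dot (x - p) y = 0.
Proof.
pose D := [set `|x - y| ^+ 2 | y in S]; pose d := inf D.
have Dlb : lbound D 0 by move=> _ [y _ <-]; exact: sqr_ge0.
have Dinf : has_inf D.
  split; last by exists 0.
  by exists (`|x - 0| ^+ 2), 0 => //; exact: subspace0.
have dlb y : S y -> d <= `|x - y| ^+ 2.
  by move=> Sy; apply: ge_inf; [exists 0|exists y].
have /choice[y_ yP] (n : nat) : exists y, S y /\ `|x - y| ^+ 2 < d + harmonic n.
  have [_ [y Sy <-] h] := inf_adherent (harmonic_gt0 n) Dinf.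
  by exists y.
have half_dist m n : `|y_ m - y_ n| ^+ 2 <= 2 * (harmonic m + harmonic n).
  have [Sm hm] := yP m; have [Sn hn] := yP n.
  (* parallelogram law, with the midpoint of y_ m and y_ n *)
  have := dlb _ (subspaceZ 2^-1 _ (subspaceD _ _ Sm Sn)).
  move: hm hn.
  rewrite !sqr_normE !(dotBl, dotBr, dotDl, dotDr, dotZl, dotZr).
  rewrite !(dotC _ x) (dotC (y_ n)).
  set a := dot _ _; set b := dot _ _; set c := dot _ _; set e := dot _ _.
  move: (dot _ _) => f.
  lra.
have ycvg : cvgn y_.
  apply/cauchy_cvgP/cauchy_ballP => e e0; near_simpl.
  have ee : 0 < e ^+ 2 / 4 by rewrite divr_gt0// exprn_gt0.
  have small : \forall k \near \oo, harmonic k < e ^+ 2 / 4.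
    have /cvgrPdist_lt/(_ _ ee) := @cvg_harmonic R; apply: filterS => k.
    by rewrite sub0r normrN ger0_norm// ltW// harmonic_gt0.
  near=> m n => /=.
  rewrite -ball_normE /ball_/= -(@ltr_pXn2r _ 2) ?nnegrE ?(ltW e0)//.
  apply: le_lt_trans (half_dist _ _) _.
  have hm : harmonic m < e ^+ 2 / 4 by near: m.
  have hn : harmonic n < e ^+ 2 / 4 by near: n.
  lra.
exists (limn y_).
have Sp : S (limn y_).
  apply: (closed_cvg S _ _ _ ycvg); first by have [] := hS.
  by apply: nearW => n; have [] := yP n.
split=> // y Sy.
have dp : dot (x - limn y_) (x - limn y_) <= d.
  rewrite -sqr_normE -[leRHS]addr0; apply: (@ler_cvg_to _ \oo _ _
    (fun n => `|x - y_ n| ^+ 2) (fun n => d + harmonic n)).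
  - apply: (@cvg_comp _ _ _ (fun n => `|x - y_ n|) (fun r => r ^+ 2)).
      by apply: cvg_norm; apply: cvgB; [exact: cvg_cst|exact: ycvg].
    exact: exprn_continuous.
  - by apply: cvgD; [exact: cvg_cst|exact: cvg_harmonic].
  - by apply: nearW => n; have [_ /ltW] := yP n.
(* comparison of p with the competitor t *: y + p *)
have min t : 0 <= t * (t * dot y y - 2 * dot (x - limn y_) y).
  have := le_trans dp (dlb _ (subspaceP t _ _ Sy Sp)).
  rewrite sqr_normE !(dotBl, dotBr, dotDl, dotDr, dotZl, dotZr).
  rewrite (dotC y x) (dotC (limn y_) x) (dotC (limn y_) y).
  lra.
set c := dot (x - limn y_) y in min *; set s := dot y y in min *.
have s0 : 0 <= s := dot_ge0 y.
have s1 : s + 1 != 0 by rewrite gt_eqF// ltr_wpDl.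
(* the minimizing t would be c / s; s + 1 avoids the case s = 0, and the value
   at t is still negative unless c = 0 *)
have := min (c / (s + 1)).
have -> : c / (s + 1) * (c / (s + 1) * s - 2 * c) =
   - ((c / (s + 1)) ^+ 2 * (s + 2)) by field.
rewrite oppr_ge0 => h.
have : (c / (s + 1)) ^+ 2 <= 0.
  by rewrite -(pmulr_lle0 _ (_ : 0 < s + 2)) // ltr_wpDl.
by rewrite exprn_even_le0//= mulf_eq0 invr_eq0 (negPf s1) orbF => /eqP.
Unshelve. all: by end_near. Qed.

End Projection.

(** [orth_proj] is defined for affine subspaces too, by orthogonality to the
    differences y - p; on a linear subspace these are all its vectors. *)
Lemma orth_projP (S : set X) (hS : closed_subspace S) x :
  S (orth_proj dot S x) /\
  forall y, S y -> dot (x - orth_proj dot S x) y = 0.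
Proof.
rewrite /orth_proj.
have [p [Sp xp]] := projection_theorem S hS x.
have ex : exists q, S q /\ forall y, S y -> dot (x - q) (y - q) = 0.
  by exists p; split=> // y Sy; apply: xp; exact: subspaceB.
have [] := @xgetPex _ 0 _ ex.
move: (xget _ _) => q Sq qP; split=> // y Sy.
by rewrite -(addrK q y) qP//; exact: subspaceD.
Qed.

Lemma full_of_trivial_orth (V : set X) : closed_subspace V ->
  (forall w, (forall v, V v -> dot w v = 0) -> w = 0) -> forall u, V u.
Proof.
move=> hV w0 u; have [Vp up] := orth_projP V hV u.
by have /subr0_eq -> := w0 _ up.
Qed.

(** * Orthogonal complements and spaces of test vectors *)

Definition orth_compl (A : set X) : set X :=
  [set y | forall a, A a -> dot a y = 0].

Lemma orth_compl_closed_subspace (A : set X) : closed_subspace (orth_compl A).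
Proof.
split.
  have -> : orth_compl A = \bigcap_(a in A) (dot a @^-1` [set 0]).
    by apply/seteqP; split.
  apply: closed_bigI => a _; apply: preimage_closed; last exact: closed_eq.
  by move=> v _; exact: dot_continuous.
split; first by apply: mem_set => a _; exact: dot0r.
move=> t u v /set_mem Au /set_mem Av; apply: mem_set => a Aa.
by rewrite dotDr dotZr Au// Av// mulr0 addr0.
Qed.

Lemma lin_span_orth (A : set X) u y : lin_span A u -> orth_compl A y ->
  dot u y = 0.
Proof.
move=> [n [c [v [Av ->]]]] Ay.
rewrite dot_suml big1// => j _.
by rewrite dotZl Ay ?mulr0.
Qed.

(** Boundedness of z is what makes this space closed: it bounds the error of
    replacing u by a nearby test vector, uniformly in i. *)
Lemma weak_limits_closed_subspace (z : nat -> X) (C : R) :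
  (forall i, `|z i| <= C) ->
  closed_subspace [set u | dot (z i) u @[i --> \oo] --> (0 : R)].
Proof.
move=> zC; have C0 : 0 <= C by rewrite (le_trans _ (zC 0%N)).
split.
  move=> u clu; apply/cvgr0Pnorm_le => e e0.
  have d0 : 0 < e / 2 / (C + 1) by rewrite !divr_gt0// ltr_wpDl.
  have [v [/= zv uv]] := clu _ (nbhsx_ballx u _ d0).
  have e2 : 0 < e / 2 by rewrite divr_gt0.
  move/cvgr0Pnorm_le : zv => /(_ _ e2); apply: filterS => i zvi.
  rewrite -(subrK v u) dotDr (splitr e).
  apply: le_trans (ler_normD _ _) _; apply: lerD => //.
  apply: le_trans (cauchy_schwarz _ _) _.
  have -> : e / 2 = (C + 1) * (e / 2 / (C + 1)).
    by rewrite [RHS]mulrC divfK// gt_eqF// ltr_wpDl.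
  apply: ler_pM => //; first by rewrite (le_trans (zC i))// lerDl.
  by move: uv; rewrite -ball_normE /ball_/= => /ltW.
split.
  by apply: mem_set => /=; under eq_fun do rewrite dot0r; exact: cvg_cst.
move=> t u v /set_mem/= zu /set_mem/= zv; apply: mem_set => /=.
under eq_fun do rewrite dotDr dotZr.
rewrite -(addr0 (0 : R)); apply: cvgD => //.
by rewrite -(mulr0 t); apply: cvgM => //; exact: cvg_cst.
Qed.

End InnerProduct.

Lemma sqr_norm_cvg0 (R : realType) (X : completeNormedModType R)
    (u : nat -> X) :
  `|u i| ^+ 2 @[i --> \oo] --> (0 : R) -> u @ \oo --> (0 : X).
Proof.
move=> /cvgr0Pnorm_le u0; apply/cvgr0Pnorm_le => e e0.
have := u0 _ (exprn_gt0 2 e0); apply: filterS => i.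
by rewrite normrX normr_id ler_pXn2r ?nnegrE ?(ltW e0).
Qed.

(** The window has fixed length, so this is a finite sum of null sequences; the
    length will be the bound on the delays in (A). *)
Lemma cvg0_window_sum (R : realType) (d : nat -> R) n :
  d @ \oo --> (0 : R) ->
  \sum_(q < n) d (i + q)%N @[i --> \oo] --> (0 : R).
Proof.
move=> d0; elim: n => [|n IHn].
  by under eq_fun do rewrite big_ord0; exact: cvg_cst.
under eq_fun do rewrite big_ord_recr/=.
rewrite -[in nbhs _](addr0 (0 : R)); apply: cvgD => //.
exact: (cvg_comp _ _ (cvg_addnr n) d0).
Qed.

(** * Runs of the algorithm *)

Section Run.
Context {R : realType} {X : completeNormedModType R} (dot : {dot X for idfun}).
Hypothesis hX : hilbert_space dot.
Context (k : nat) (M : 'I_k -> set X).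
Hypothesis hM : forall m, closed_subspace (M m).
Context (x0 : X) (x xt : nat -> X) (l : nat -> 'I_k) (J : nat -> set nat).
Hypothesis hrun : accelerated_projections dot M x0 x xt l J.
Hypothesis hB : forall i : nat,
  lin_span [set ap_a dot M x l j | j in J i] (x0 - x i).

Let a := ap_a dot M x l.
Let Ht := ap_Ht dot M x l J.
Let Mcap := \bigcap_m M m.

Lemma residual_orth i y : M (l i) y -> dot (a i) y = 0.
Proof. by have [_ h] := orth_projP dot hX _ (hM (l i)) (x i); exact: h. Qed.

(** [ap_b] vanishes because M_(l i) is linear and contains the projection of
    x_i; so the affine hyperplanes of the algorithm are linear. *)
Lemma HtE i : Ht i = orth_compl dot [set a j | j in J i].
Proof.
have b0 j : ap_b dot M x l j = 0.
  by apply: residual_orth; have [] := orth_projP dot hX _ (hM (l j)) (x j).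
apply/seteqP; split=> [y Hy _ [j Jj <-]|y Ay j Jj].
  by rewrite -(b0 j); exact: Hy.
by rewrite /ap_H /= b0; apply: Ay; exists j.
Qed.

Lemma Ht_closed_subspace i : closed_subspace (Ht i).
Proof. by rewrite HtE; exact: orth_compl_closed_subspace. Qed.

Lemma Mcap_sub_Ht i : Mcap `<=` Ht i.
Proof.
by move=> y My; rewrite HtE => _ [j _ <-]; apply: residual_orth; exact: My.
Qed.

Lemma step_in_Ht i : Ht i (x i.+1).
Proof.
rewrite (ap_step2 hrun).
by have [] := orth_projP dot hX _ (Ht_closed_subspace i) (xt i).
Qed.

(** So x_(i+1) is the projection on Ht_i of x_i itself, not only of xt_i: the
    first half-step a_i is normal to Ht_i as i is in J_i. *)
Lemma step_orth_Ht i y : Ht i y -> dot (x i - x i.+1) y = 0.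
Proof.
move=> Hy; have -> : x i - x i.+1 = a i + (xt i - x i.+1).
  by rewrite /a /ap_a -(ap_step1 hrun) addrA subrK.
have [_ h] := orth_projP dot hX _ (Ht_closed_subspace i) (xt i).
rewrite dotDl (ap_step2 hrun) h// addr0.
by move: Hy; rewrite HtE; apply; exists i => //; exact: (ap_J_self hrun).
Qed.

Lemma drift_orth_Ht i y : Ht i y -> dot (x0 - x i) y = 0.
Proof. by rewrite HtE; apply: lin_span_orth; exact: hB. Qed.

Lemma drift_orth_Mcap i y : Mcap y -> dot (x0 - x i) y = 0.
Proof. by move=> /(Mcap_sub_Ht i); exact: drift_orth_Ht. Qed.

(** Going from x_i to x_(i+1) adds to x0 - x_i a vector normal to Ht_i; by (B),
    x0 - x_i is normal to Ht_i already, and x_(i+1) is in Ht_i. *)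
Lemma drift_orth_iterate i : dot (x0 - x i) (x i) = 0.
Proof.
case: i => [|i]; first by rewrite (ap_init hrun) subrr dot0l.
rewrite -(subrK (x i) x0) -addrA dotDl.
by rewrite drift_orth_Ht ?step_orth_Ht ?addr0//; exact: step_in_Ht.
Qed.

(** Pythagoras, the step being orthogonal to its endpoint x_(i+1). *)
Lemma sqr_norm_step i :
  `|x i - x i.+1| ^+ 2 = `|x i| ^+ 2 - `|x i.+1| ^+ 2.
Proof.
have := step_orth_Ht i _ (step_in_Ht i).
rewrite !(sqr_normE dot hX) !(dotBl, dotBr) (dotC dot (x i.+1) (x i)).
lra.
Qed.

Lemma sqr_norm_decr i : `|x i.+1| ^+ 2 <= `|x i| ^+ 2.
Proof. by rewrite -subr_ge0 -sqr_norm_step sqr_ge0. Qed.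

Lemma iterate_bounded i : `|x i| <= `|x 0%N|.
Proof.
rewrite -(@ler_pXn2r _ 2) ?nnegrE//.
by elim: i => // i; apply: le_trans; exact: sqr_norm_decr.
Qed.

Lemma step_cvg0 : (x i - x i.+1) @[i --> \oo] --> (0 : X).
Proof.
apply: sqr_norm_cvg0; under eq_fun do rewrite sqr_norm_step.
have cv : cvgn (fun i => `|x i| ^+ 2).
  apply: nonincreasing_is_cvgn.
    by apply/nonincreasing_seqP => i; exact: sqr_norm_decr.
  by exists 0 => _ [i _ <-]; exact: sqr_ge0.
rewrite -(subrr (limn (fun i => `|x i| ^+ 2))); apply: cvgB => //.
by rewrite (cvg_shiftS (fun i => `|x i| ^+ 2)).
Qed.

(** H_i contains x_(i+1) and |a_i| is the distance from x_i to H_i. *)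
Lemma residual_le_step i : `|a i| <= `|x i - x i.+1|.
Proof.
have [->|a0] := eqVneq (a i) 0; first by rewrite normr0.
have na0 : 0 < `|a i| by rewrite normr_gt0.
have -> : `|a i| = dot (a i) (x i - x i.+1) / `|a i|.
  have -> : dot (a i) (x i - x i.+1) = `|a i| ^+ 2.
    have Ha : dot (a i) (x i.+1) = 0.
      have := step_in_Ht i; rewrite HtE; apply.
      by exists i => //; exact: (ap_J_self hrun).
    have [Mp _] := orth_projP dot hX _ (hM (l i)) (x i).
    rewrite (sqr_normE dot hX) dotBr Ha subr0.
    by rewrite {3}/a /ap_a dotBr (residual_orth _ _ Mp) subr0.
  by rewrite expr2 mulfK// gt_eqF.
rewrite ler_pdivrMr// mulrC.
exact: le_trans (ler_norm _) (cauchy_schwarz dot hX _ _).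
Qed.

Lemma dist_le_sum_steps i p :
  `|x i - x (i + p)%N| <= \sum_(q < p) `|x (i + q)%N - x (i + q).+1|.
Proof.
elim: p => [|p IHp]; first by rewrite addn0 subrr normr0 big_ord0.
rewrite big_ord_recr/= addnS.
apply: le_trans (ler_distD (x (i + p)%N) _ _) _.
by rewrite lerD.
Qed.

Hypothesis hA : exists pbar : nat, forall (m : 'I_k) (i : nat), (0 < i)%N ->
  exists p : nat, (p <= pbar)%N /\
    xt (i + p)%N = orth_proj dot (M m) (x (i + p)%N).

(** Within pbar steps of i comes an i + p such that xt_(i+p) is in M_m; its
    distance to x_i is at most the sum of p steps and one residual, all of which
    vanish as i grows. *)
Lemma dot_orth_cvg0 m u : (forall y, M m y -> dot y u = 0) ->
  dot (x i) u @[i --> \oo] --> (0 : R).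
Proof.
move=> Mu; have [pbar hp] := hA.
pose d i := `|x i - x i.+1|.
have d0 : d @ \oo --> (0 : R).
  by rewrite -(normr0 X); apply: cvg_norm; exact: step_cvg0.
apply/norm_cvg0P.
apply: (@squeeze_cvgr _ _ _ _ (fun=> 0)
   (fun i => (\sum_(q < pbar.+1) d (i + q)%N) * `|u|)); last first.
- suff : (\sum_(q < pbar.+1) d (i + q)%N) * `|u| @[i --> \oo]
      --> (0 : R) * `|u|.
    by rewrite mul0r.
  by apply: cvgM; [exact: cvg0_window_sum|exact: cvg_cst].
- exact: cvg_cst.
exists 1%N => // i /= i0; rewrite normr_ge0/=.
have [p [ppbar xtp]] := hp m i i0.
have [Mp _] := orth_projP dot hX _ (hM m) (x (i + p)%N).
have -> : dot (x i) u = dot (x i - xt (i + p)%N) u.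
  by rewrite dotBl xtp (Mu _ Mp) subr0.
apply: le_trans (cauchy_schwarz dot hX _ _) _; rewrite ler_wpM2r//.
apply: le_trans (ler_distD (x (i + p)%N) _ _) _.
apply: (@le_trans _ _ (\sum_(q < p.+1) d (i + q)%N)).
  rewrite big_ord_recr/=; apply: lerD; first exact: dist_le_sum_steps.
  by rewrite (ap_step1 hrun); exact: residual_le_step.
rewrite -!(big_mkord xpredT (fun q => d (i + q)%N)).
rewrite (@big_cat_nat _ _ _ p.+1 0 pbar.+1)//= lerDl.
by apply: sumr_ge0 => q _; exact: normr_ge0.
Qed.

Lemma Mcap_closed_subspace : closed_subspace Mcap.
Proof.
split; first by apply: closed_bigI => m _; have [] := hM m.
split; first by apply: mem_set => m _; exact: subspace0.
move=> t u v /set_mem Mu /set_mem Mv; apply: mem_set => m _.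
by apply: subspaceP => //; [exact: Mu|exact: Mv].
Qed.

Lemma iterates_cvg : x @ \oo --> orth_proj dot Mcap x0.
Proof.
have [My yP] := orth_projP dot hX _ Mcap_closed_subspace x0.
set y := orth_proj _ _ _ in My yP *.
(* x_i - y = (x0 - y) - (x0 - x_i), a difference of normals to Mcap *)
have zMcap i w : Mcap w -> dot (x i - y) w = 0.
  move=> Mw; rewrite -(subrK x0 (x i)) -addrA dotDl yP// addr0.
  by rewrite -opprB -scaleN1r dotZl drift_orth_Mcap// mulr0.
have zbnd i : `|x i - y| <= `|x 0%N| + `|y|.
  by apply: le_trans (ler_normB _ _) _; rewrite lerD2r iterate_bounded.
have zweak u : dot (x i - y) u @[i --> \oo] --> (0 : R).
  move: u; apply: full_of_trivial_orth.
  - exact: hX.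
  - exact: weak_limits_closed_subspace zbnd.
  move=> w wV.
  have Mw : Mcap w.
    move=> m _; have [Mp wp] := orth_projP dot hX _ (hM m) w.
    suff /subr0_eq -> : w - orth_proj dot (M m) w = 0 by [].
    apply: (dot_eq0 dot); rewrite dotBr (wp _ Mp) subr0 dotC wV//=.
    (* w - P w is orthogonal to M m, hence one of the test vectors *)
    have Mwp v : M m v -> dot v (w - orth_proj dot (M m) w) = 0.
      by move=> Mv; rewrite dotC wp.
    have xw i : dot (x i - y) (w - orth_proj dot (M m) w) =
        dot (x i) (w - orth_proj dot (M m) w).
      by rewrite dotBl (Mwp y (My m I)) subr0.
    under eq_fun do rewrite xw.
    exact: dot_orth_cvg0 Mwp.
  apply: (dot_eq0 dot); apply: wV => /=.
  by under eq_fun do rewrite zMcap//; exact: cvg_cst.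
apply/cvgrPdist_le; have /cvgr0Pnorm_le z0 : (x i - y) @[i --> \oo] --> (0 : X).
  apply: sqr_norm_cvg0.
  (* x_i - x0 is orthogonal to x_i and to y, hence to x_i - y *)
  have sqE i : `|x i - y| ^+ 2 = dot (x i - y) (x0 - y).
    have := drift_orth_iterate i; have := drift_orth_Mcap i _ My.
    rewrite (sqr_normE dot hX) !(dotBl, dotBr) (dotC dot y (x i)).
    by rewrite (dotC dot (x i) x0) (dotC dot y x0); lra.
  by under eq_fun do rewrite sqE; exact: zweak.
by move=> e /z0; apply: filterS => i; rewrite distrC.
Qed.

End Run.

Theorem theorem3p11 (R : realType) (X : completeNormedModType R)
    (dot : {dot X for idfun}) (hX : hilbert_space dot)
    (k : nat) (M : 'I_k -> set X) (hM : forall m, closed_subspace (M m))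
    (x0 : X) (x xt : nat -> X) (l : nat -> 'I_k) (J : nat -> set nat)
    (hrun : accelerated_projections dot M x0 x xt l J)
    (hA : exists pbar : nat, forall (m : 'I_k) (i : nat), (0 < i)%N ->
       exists p : nat, (p <= pbar)%N /\
         xt (i + p)%N = orth_proj dot (M m) (x (i + p)%N))
    (hB : forall i : nat,
       lin_span [set ap_a dot M x l j | j in J i] (x0 - x i)) :
  x @ \oo --> orth_proj dot (\bigcap_m M m) x0.
Proof. exact: iterates_cvg hX _ _ hM _ _ _ _ _ hrun hB hA. Qed.
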